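(* Let $(\Sigma,\mathscr R)$ be a Dedukti theory. If $\hookrightarrow_{\beta\mathscr R}$ is confluent and $\mathscr R$ is arity-preserving, then $\beta$-reduction is strongly normalizing on well-typed terms: for every $\Gamma,M,A$ with $\Sigma;\Gamma\vdash M:A$, there is no infinite sequence $M=M_1\hookrightarrow_\beta M_2\hookrightarrow_\beta M_3\hookrightarrow_\beta\cdots$.
   Context: Dedukti terms are given by $A,B,M,N ::= x \mid c[M_1,\dots,M_{n_c}] \mid \mathtt{TYPE} \mid \mathtt{KIND} \mid M\,N \mid \lambda x:A.M \mid \Pi x:A.B$, where $x$ ranges over an infinite set of variables and $c$ over an infinite set of constants, each constant $c$ having a fixed arity $n_c$; $A\to B$ abbreviates $\Pi x:A.B$ with $x$ not free in $B$. A context $\Gamma$ is a finite sequence of declarations $x:A$; a signature $\Sigma$ is a finite set of declarations $c[\Delta]:A$ with $\Delta$ a context of length $n_c$ containing all free variables of $A$. A rewrite rule is a pair $c[\vec l]\hookrightarrow r$; a theory is a pair $(\Sigma,\mathscr R)$ with $\mathscr R$ a set of rules whose constants are declared in $\Sigma$; $\hookrightarrow_{\mathscr R}$ is the closure of $\mathscr R$ under contexts and substitutions, $\hookrightarrow_{\beta\mathscr R}=\hookrightarrow_\beta\cup\hookrightarrow_{\mathscr R}$, and $\equiv$ is the equivalence generated by $\hookrightarrow_{\beta\mathscr R}$. With $s$ ranging over $\{\mathtt{TYPE},\mathtt{KIND}\}$, typing is given by: (Empty) $\Sigma;-$ well-formed; (Decl) if $\Sigma;\Gamma\vdash A:\mathtt{TYPE}$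 and $x\notin\Gamma$ then $\Sigma;\Gamma,x:A$ well-formed; (Cons) if $c[\Delta]:A\in\Sigma$, $\Sigma;\Delta\vdash A:s$ and $\Sigma;\Gamma\vdash\vec M:\Delta$ then $\Sigma;\Gamma\vdash c[\vec M]:A\{\vec M\}$, where for $\Delta=x_1:A_1,\dots,x_n:A_n$, $\Sigma;\Gamma\vdash\vec M:\Delta$ means $\Sigma;\Gamma\vdash M_i:A_i\{M_1/x_1\}\cdots\{M_{i-1}/x_{i-1}\}$ for each $i$, and $A\{\vec M\}=A\{M_1/x_1\}\cdots\{M_n/x_n\}$; (Sort) if $\Sigma;\Gamma$ well-formed then $\Sigma;\Gamma\vdash\mathtt{TYPE}:\mathtt{KIND}$; (Var) if $\Sigma;\Gamma$ well-formed and $x:A\in\Gamma$ then $\Sigma;\Gamma\vdash x:A$; (Conv) if $\Sigma;\Gamma\vdash M:A$, $\Sigma;\Gamma\vdash B:s$ and $A\equiv B$ then $\Sigma;\Gamma\vdash M:B$; (Prod) if $\Sigma;\Gamma\vdash A:\mathtt{TYPE}$ and $\Sigma;\Gamma,x:A\vdash B:s$ then $\Sigma;\Gamma\vdash\Pi x:A.B:s$; (App) if $\Sigma;\Gamma\vdash M:\Pi x:A.B$ and $\Sigma;\Gamma\vdash N:A$ then $\Sigma;\Gamma\vdash M\,N:B\{N/x\}$; (Abs) if $\Sigma;\Gamma\vdash A:\mathtt{TYPE}$, $\Sigma;\Gamma,x:A\vdash B:s$ and $\Sigma;\Gamma,x:A\vdash M:B$ then $\Sigma;\Gamma\vdash\lambda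 x:A.M:\Pi x:A.B$. Given $\Sigma$, a constant $c$ is type-level (written $\alpha$) if $c[\Delta]:A\in\Sigma$ with $A$ of the form $\Pi\vec x:\vec B.\mathtt{TYPE}$, and object-level otherwise; a rewrite rule is type-level if its head constant is type-level. $\mathscr R$ is arity-preserving if the right-hand side of every type-level rule of $\mathscr R$ belongs to the grammar $R::=\alpha[\vec M]\mid R\,N\mid\lambda x:A.R$ with $\alpha$ type-level and $\vec M,N,A$ arbitrary terms.
   Formalization: In rule (Cons) the context Γ is additionally required to be well-formed; this matters only for constants of arity 0, and without it such constants are typable in ill-formed contexts and the claim fails. *)

(* Defs.v *)
From Stdlib Require Import Relations.
From Stdlib Require List.
From mathcomp Require Import all_boot.

Set Implicit Arguments.
Unset Strict Implicit.
Unset Printing Implicit Defensive.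

Record language := Language {
  const : Type;
  arity : const -> nat;
  const_infinite : exists f : nat -> const, injective f
}.

Inductive dsort := SType | SKind.

(** Terms are taken up to renaming of bound variables: variables are de Bruijn
    indices, and [Lam A M], [Prod A B] bind index 0 in their second argument
    only.  In [Const c Ms] the argument written M_(i+1) on paper is [Ms i]. *)
Inductive term (L : language) :=
| Var of nat
| Const (c : const L) of {ffun 'I_(arity c) -> term L}
| Sort of dsort
| App of term L & term L
| Lam of term L & term L
| Prod of term L & term L.

Arguments Var {L} n.
Arguments Sort {L} s.

Notation TYPE := (Sort SType).
Notation KIND := (Sort SKind).

Section Dedukti.
Variable L : language.
Implicit Types (A B M N : term L) (c : const L) (s : dsort).

Definition up_ren (xi : nat -> nat) (k : nat) : nat :=
  if k is k'.+1 then (xi k').+1 else 0.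

Fixpoint rename (xi : nat -> nat) M : term L :=
  match M with
  | Var k => Var (xi k)
  | Const c Ms => Const [ffun i => rename xi (Ms i)]
  | Sort s => Sort s
  | App M N => App (rename xi M) (rename xi N)
  | Lam A M => Lam (rename xi A) (rename (up_ren xi) M)
  | Prod A B => Prod (rename xi A) (rename (up_ren xi) B)
  end.

Definition up (sigma : nat -> term L) (k : nat) : term L :=
  if k is k'.+1 then rename succn (sigma k') else Var 0.

Fixpoint subst (sigma : nat -> term L) M : term L :=
  match M with
  | Var k => sigma k
  | Const c Ms => Const [ffun i => subst sigma (Ms i)]
  | Sort s => Sort s
  | App M N => App (subst sigma M) (subst sigma N)
  | Lam A M => Lam (subst sigma A) (subst (up sigma) M)
  | Prod A B => Prod (subst sigma A) (subst (up sigma) B)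
  end.

(** Replaces index k by the k-th item of [s] and lowers the indices beyond
    [size s], which refer to the ambient context. *)
Definition inst (s : seq (term L)) : nat -> term L :=
  fun k => nth (Var (k - size s)) s k.

Definition subst1 M N : term L := subst (inst [:: N]) M.

(** The last argument instantiates index 0, whence the reversal; substituting
    simultaneously agrees with A{M_1/x_1}...{M_n/x_n} for fresh x_1,...,x_n. *)
Definition subst_args (Ms : seq (term L)) A : term L := subst (inst (rev Ms)) A.

Fixpoint var_occurs (k : nat) M : Prop :=
  match M with
  | Var j => j = k
  | Const c Ms => exists i, var_occurs k (Ms i)
  | Sort _ => False
  | App M N => var_occurs k M \/ var_occurs k N
  | Lam A M => var_occurs k A \/ var_occurs k.+1 M
  | Prod A B => var_occurs k A \/ var_occurs k.+1 B
  end.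

Fixpoint const_occurs (c : const L) M : Prop :=
  match M with
  | Var _ => False
  | Const d Ms => d = c \/ exists i, const_occurs c (Ms i)
  | Sort _ => False
  | App M N => const_occurs c M \/ const_occurs c N
  | Lam A M => const_occurs c A \/ const_occurs c M
  | Prod A B => const_occurs c A \/ const_occurs c B
  end.

(** The head of a context is its most recent declaration, i.e. [A :: G] is
    the context written G, x : A. *)
Definition context := seq (term L).

Record decl := Decl {
  dconst : const L;
  dctx : (arity dconst).-tuple (term L);
  dtype : term L;
  dtype_closed : forall k, var_occurs k dtype -> k < arity dconst
}.

Definition signature := seq decl.

Definition declared (S : signature) c : Prop :=
  exists2 d, List.In d S & dconst d = c.

(** The free indices of both sides are the pattern variables of the rule. *)
Record rule := Rule {
  rhead : const L;
  rargs : {ffun 'I_(arity rhead) -> term L};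
  rrhs : term L
}.

Definition rlhs (rho : rule) : term L := Const (rargs rho).

Record theory := Theory {
  tsig : signature;
  trules : rule -> Prop;
  trules_declared : forall rho, trules rho -> forall c,
    const_occurs c (rlhs rho) \/ const_occurs c (rrhs rho) -> declared tsig c
}.

Inductive ctx_closure (R : relation (term L)) : relation (term L) :=
| cc_root M N : R M N -> ctx_closure R M N
| cc_const c (Ms Ns : {ffun 'I_(arity c) -> term L}) (i : 'I_(arity c)) :
    ctx_closure R (Ms i) (Ns i) -> (forall j, j != i -> Ns j = Ms j) ->
    ctx_closure R (Const Ms) (Const Ns)
| cc_app_l M M' N : ctx_closure R M M' -> ctx_closure R (App M N) (App M' N)
| cc_app_r M N N' : ctx_closure R N N' -> ctx_closure R (App M N) (App M N')
| cc_lam_l A A' M : ctx_closure R A A' -> ctx_closure R (Lam A M) (Lam A' M)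
| cc_lam_r A M M' : ctx_closure R M M' -> ctx_closure R (Lam A M) (Lam A M')
| cc_prod_l A A' B : ctx_closure R A A' -> ctx_closure R (Prod A B) (Prod A' B)
| cc_prod_r A B B' : ctx_closure R B B' -> ctx_closure R (Prod A B) (Prod A B').

Inductive beta_root : relation (term L) :=
| BetaRoot A M N : beta_root (App (Lam A M) N) (subst1 M N).

Inductive rule_root (R : rule -> Prop) : relation (term L) :=
| RuleRoot rho sigma :
    R rho -> rule_root R (subst sigma (rlhs rho)) (subst sigma (rrhs rho)).

Definition beta : relation (term L) := ctx_closure beta_root.

Definition rew (R : rule -> Prop) : relation (term L) :=
  ctx_closure (rule_root R).

Definition beta_rew (R : rule -> Prop) : relation (term L) :=
  union (term L) beta (rew R).

Definition conv (R : rule -> Prop) : relation (term L) :=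
  clos_refl_sym_trans (term L) (beta_rew R).

Definition confluent (R : relation (term L)) : Prop :=
  forall M N1 N2,
    clos_refl_trans (term L) R M N1 -> clos_refl_trans (term L) R M N2 ->
    exists2 P, clos_refl_trans (term L) R N1 P
             & clos_refl_trans (term L) R N2 P.

(** In [ty_cons], [wf T G] follows from the typing of the arguments unless
    there are none; for a constant of arity 0 it is what G |- () : () means.
    Without it, constants of arity 0 would be typable in ill-formed contexts,
    and by [wf_decl] an ill-formed context could be extended to a well-formed
    one. *)
Inductive wf (T : theory) : context -> Prop :=
| wf_empty : wf T [::]
| wf_decl G A : has_type T G A TYPE -> wf T (A :: G)
with has_type (T : theory) : context -> term L -> term L -> Prop :=
| ty_cons G (d : decl) (Ms : {ffun 'I_(arity (dconst d)) -> term L}) s :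
    List.In d (tsig T) ->
    has_type T (dctx d) (dtype d) (Sort s) ->
    wf T G ->
    (forall i : 'I_(arity (dconst d)),
       has_type T G (Ms i)
         (subst_args (take i (codom Ms)) (nth TYPE (rev (dctx d)) i))) ->
    has_type T G (Const Ms) (subst_args (codom Ms) (dtype d))
| ty_sort G : wf T G -> has_type T G TYPE KIND
| ty_var G k A :
    wf T G -> onth G k = Some A ->
    has_type T G (Var k) (rename (addn k.+1) A)
| ty_conv G M A B s :
    has_type T G M A -> has_type T G B (Sort s) -> conv (trules T) A B ->
    has_type T G M B
| ty_prod G A B s :
    has_type T G A TYPE -> has_type T (A :: G) B (Sort s) ->
    has_type T G (Prod A B) (Sort s)
| ty_app G M N A B :
    has_type T G M (Prod A B) -> has_type T G N A ->
    has_type T G (App M N) (subst1 B N)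
| ty_abs G A B M s :
    has_type T G A TYPE -> has_type T (A :: G) B (Sort s) ->
    has_type T (A :: G) M B ->
    has_type T G (Lam A M) (Prod A B).

Inductive prod_to_TYPE : term L -> Prop :=
| ptt_TYPE : prod_to_TYPE TYPE
| ptt_prod A B : prod_to_TYPE B -> prod_to_TYPE (Prod A B).

Definition type_level (S : signature) c : Prop :=
  exists d, [/\ List.In d S, dconst d = c & prod_to_TYPE (dtype d)].

Inductive arity_preserving_rhs (S : signature) : term L -> Prop :=
| apr_const c (Ms : {ffun 'I_(arity c) -> term L}) :
    type_level S c -> arity_preserving_rhs S (Const Ms)
| apr_app M N : arity_preserving_rhs S M -> arity_preserving_rhs S (App M N)
| apr_lam A M : arity_preserving_rhs S M -> arity_preserving_rhs S (Lam A M).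

Definition arity_preserving (T : theory) : Prop :=
  forall rho, trules T rho -> type_level (tsig T) (rhead rho) ->
    arity_preserving_rhs (tsig T) (rrhs rho).

End Dedukti.

(* Main.v *)
(** Every well-formed type or kind erases to a simple type by forgetting the
    dependencies and mapping all type-level constants and TYPE to one base
    type.  Families and kinds are recognised by their head alone, and
    arity-preservation makes both their syntactic shape and their erasure
    stable under all reductions, including untyped ones; with confluence, the
    erasure is therefore invariant under conversion, and subject reduction is
    not needed.  Typed terms then belong to the reducibility candidate of the
    erasure of their type.  Constants, sorts and products never form a beta
    redex in head position, so they behave as neutral terms. *)
Require Import Defs.
From Stdlib Require Import Relations.
From mathcomp Require Import all_boot.

Set Implicit Arguments.
Unset Strict Implicit.
Unset Printing Implicit Defensive.

(** * Substitution calculus for de Bruijn terms *)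

Section Substitution.
Variable L : language.
Implicit Types (A B M N P : term L).

(* The generated principle gives no hypothesis for the arguments of [Const]. *)
Lemma term_nested_ind (P : term L -> Prop) :
  (forall k, P (Var k)) ->
  (forall c (Ms : {ffun 'I_(arity c) -> term L}),
     (forall i, P (Ms i)) -> P (Const Ms)) ->
  (forall s, P (Sort s)) ->
  (forall M N, P M -> P N -> P (App M N)) ->
  (forall A M, P A -> P M -> P (Lam A M)) ->
  (forall A B, P A -> P B -> P (Prod A B)) ->
  forall M, P M.
Proof.
move=> Hvar Hconst Hsort Happ Hlam Hprod; fix IH 1.
case=> [k|c Ms|s|M N|A M|A B].
- exact: Hvar.
- by apply: Hconst => i; apply: IH.
- exact: Hsort.
- by apply: Happ; apply: IH.
- by apply: Hlam; apply: IH.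
- by apply: Hprod; apply: IH.
Qed.

Lemma up_ext (s t : nat -> term L) : s =1 t -> up s =1 up t.
Proof. by move=> est [|k] //=; rewrite est. Qed.

Lemma subst_ext M : forall s t : nat -> term L, s =1 t -> subst s M = subst t M.
Proof.
elim/term_nested_ind: M => [k|c Ms IH|s|M N IHM IHN|A M IHA IHM|A B IHA IHB]
  s1 t1 est //=.
- by congr Const; apply/ffunP=> i; rewrite !ffunE; apply: IH.
- by rewrite (IHM _ _ est) (IHN _ _ est).
- by rewrite (IHA _ _ est) (IHM _ _ (up_ext est)).
- by rewrite (IHA _ _ est) (IHB _ _ (up_ext est)).
Qed.

Lemma subst_var M : forall s, s =1 Var -> subst s M = M.
Proof.
elim/term_nested_ind: M => [k|c Ms IH|s|M N IHM IHN|A M IHA IHM|A B IHA IHB]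
  s1 es //=.
- by congr Const; apply/ffunP=> i; rewrite !ffunE; apply: IH.
- by rewrite IHM // IHN.
- by rewrite IHA // IHM // => -[|k] //=; rewrite es.
- by rewrite IHA // IHB // => -[|k] //=; rewrite es.
Qed.

Lemma rename_subst M : forall xi, rename xi M = subst (fun k => Var (xi k)) M.
Proof.
have upE xi : up (fun k => Var (xi k)) =1 fun k => Var (up_ren xi k) :> term L.
  by case.
elim/term_nested_ind: M => [k|c Ms IH|s|M N IHM IHN|A M IHA IHM|A B IHA IHB]
  xi //=.
- by congr Const; apply/ffunP=> i; rewrite !ffunE; apply: IH.
- by rewrite IHM IHN.
- by rewrite IHA IHM (subst_ext _ (upE xi)).
- by rewrite IHA IHB (subst_ext _ (upE xi)).
Qed.

Lemma subst_rename M :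
  forall xi s, subst s (rename xi M) = subst (fun k => s (xi k)) M.
Proof.
have upE xi s : (fun k => up s (up_ren xi k)) =1 up (fun k => s (xi k)) :> (nat -> term L).
  by case.
elim/term_nested_ind: M => [k|c Ms IH|s|M N IHM IHN|A M IHA IHM|A B IHA IHB]
  xi s1 //=.
- by congr Const; apply/ffunP=> i; rewrite !ffunE; apply: IH.
- by rewrite IHM IHN.
- by rewrite IHA IHM (subst_ext _ (upE xi s1)).
- by rewrite IHA IHB (subst_ext _ (upE xi s1)).
Qed.

Lemma rename_after_subst M :
  forall xi s, rename xi (subst s M) = subst (fun k => rename xi (s k)) M.
Proof.
have upE xi s :
    (fun k => rename (up_ren xi) (up s k)) =1 up (fun k => rename xi (s k))
    :> (nat -> term L).
  by case=> [|k] //=; rewrite rename_subst !subst_rename rename_subst subst_rename.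
elim/term_nested_ind: M => [k|c Ms IH|s|M N IHM IHN|A M IHA IHM|A B IHA IHB]
  xi s1 //=.
- by congr Const; apply/ffunP=> i; rewrite !ffunE; apply: IH.
- by rewrite IHM IHN.
- by rewrite IHA IHM (subst_ext _ (upE xi s1)).
- by rewrite IHA IHB (subst_ext _ (upE xi s1)).
Qed.

Lemma subst_subst M :
  forall s t, subst t (subst s M) = subst (fun k => subst t (s k)) M.
Proof.
have upE s t :
    (fun k => subst (up t) (up s k)) =1 up (fun k => subst t (s k))
    :> (nat -> term L).
  by case=> [|k] //=; rewrite subst_rename rename_after_subst.
elim/term_nested_ind: M => [k|c Ms IH|s|M N IHM IHN|A M IHA IHM|A B IHA IHB]
  s1 t1 //=.
- by congr Const; apply/ffunP=> i; rewrite !ffunE; apply: IH.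
- by rewrite IHM IHN.
- by rewrite IHA IHM (subst_ext _ (upE s1 t1)).
- by rewrite IHA IHB (subst_ext _ (upE s1 t1)).
Qed.

Definition scons N (s : nat -> term L) (k : nat) : term L :=
  if k is k'.+1 then s k' else N.

Lemma inst1E N : inst [:: N] =1 scons N Var.
Proof. by case=> [|k] //; rewrite /inst /= nth_nil subn1. Qed.

(** Bridges two ways of crossing a binder: reduction lifts the substitution, whereas the
    reducibility argument extends it with a reducible term. *)
Lemma subst1_up s M N : subst1 (subst (up s) M) N = subst (scons N s) M.
Proof.
rewrite /subst1 (subst_ext _ (inst1E N)) subst_subst; apply: subst_ext.
by case=> [|k] //=; rewrite subst_rename subst_var.
Qed.

Lemma subst_subst1 s M N :
  subst s (subst1 M N) = subst1 (subst (up s) M) (subst s N).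
Proof.
rewrite subst1_up /subst1 (subst_ext _ (inst1E N)) subst_subst.
by apply: subst_ext => -[|k].
Qed.

End Substitution.

(** * Strong normalization under beta and its closure properties *)

Section BetaNormalization.
Variable L : language.
Implicit Types (A B M N P : term L).

(** Phrased as a match on the source, so that the dependent arguments of [Const] come out without
    equalities between dependent pairs. *)
Lemma beta_inv M P : beta M P ->
  match M with
  | Var _ | Sort _ => False
  | Const c Ms => exists (Ns : {ffun 'I_(arity c) -> term L}) i,
      [/\ P = Const Ns, beta (Ms i) (Ns i) & forall j, j != i -> Ns j = Ms j]
  | App M N => [\/ exists A M0, M = Lam A M0 /\ P = subst1 M0 N,
                   exists2 M', beta M M' & P = App M' N
                 | exists2 N', beta N N' & P = App M N']
  | Lam A M => (exists2 A', beta A A' & P = Lam A' M)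
               \/ (exists2 M', beta M M' & P = Lam A M')
  | Prod A B => (exists2 A', beta A A' & P = Prod A' B)
               \/ (exists2 B', beta B B' & P = Prod A B')
  end.
Proof.
case=> {M P} [M P [A M0 N]|c Ms Ns i st eN|M M' N st|M N N' st|A A' M st
             |A M M' st|A A' B st|A B B' st].
- by constructor 1; exists A, M0.
- by exists Ns, i.
- by constructor 2; exists M'.
- by constructor 3; exists N'.
- by left; exists A'.
- by right; exists M'.
- by left; exists A'.
- by right; exists B'.
Qed.

Lemma beta_subst M M' s : beta M M' -> beta (subst s M) (subst s M').
Proof.
move=> st; elim: st s => {M M'} [M M' [A M0 N]|c Ms Ns i _ IH eN|M M' N _ IH
  |M N N' _ IH|A A' M _ IH|A M M' _ IH|A A' B _ IH|A B B' _ IH] s /=.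
- by rewrite subst_subst1; apply: cc_root; constructor.
- apply: (@cc_const _ _ _ _ _ i); first by rewrite !ffunE; apply: IH.
  by move=> j ji; rewrite !ffunE eN.
- exact: (cc_app_l _ (IH s)).
- exact: (cc_app_r _ (IH s)).
- exact: (cc_lam_l _ (IH s)).
- exact: (cc_lam_r _ (IH (up s))).
- exact: (cc_prod_l _ (IH s)).
- exact: (cc_prod_r _ (IH (up s))).
Qed.

Definition sn : term L -> Prop := Acc (fun P M => beta M P).

Lemma sn_step M P : sn M -> beta M P -> sn P.
Proof. by case=> H /H. Qed.

Lemma sn_map (f : term L -> term L) M :
  (forall N P, beta N P -> beta (f N) (f P)) -> sn (f M) -> sn M.
Proof.
move=> f_beta snfM; have [Q eQ] : exists Q, Q = f M by exists (f M).
rewrite -eQ in snfM; elim: snfM M eQ => {}Q _ IH M eQ.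
by constructor=> P MP; apply: (IH (f P)) => //; rewrite eQ; apply: f_beta.
Qed.

Lemma sn_sort s : sn (Sort s).
Proof. by constructor=> P /beta_inv. Qed.

Lemma sn_prod A B : sn A -> sn B -> sn (Prod A B).
Proof.
move=> snA; elim: snA B => {}A _ IHA B snB; elim: snB => {}B snB IHB.
constructor=> P /beta_inv [[A' AA' ->]|[B' BB' ->]]; last exact: IHB.
by apply: IHA => //; constructor.
Qed.

(* [argstep n] only allows steps in the first [n] arguments, so that the
   product of the arguments can be handled by induction on [n]. *)
Definition argstep (c : const L) (n : nat) (Ns Ms : {ffun 'I_(arity c) -> term L}) : Prop :=
  exists i : 'I_(arity c),
    [/\ i < n, beta (Ms i) (Ns i) & forall j, j != i -> Ns j = Ms j].

(** Lexicographic induction: on [n], then on the normalization of the argument of index [n], then on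
    accessibility for the smaller indices, which [IHn] provides anew whenever that argument
    steps. *)
Lemma acc_argstep (c : const L) n (Ms : {ffun 'I_(arity c) -> term L}) :
  (forall i, sn (Ms i)) -> Acc (@argstep c n) Ms.
Proof.
have sn_args (Ns Ps : {ffun 'I_(arity c) -> term L}) i :
    (forall j, sn (Ns j)) -> beta (Ns i) (Ps i) ->
    (forall j, j != i -> Ps j = Ns j) -> forall j, sn (Ps j).
  move=> snN st eP j; have [->|/eP->] := eqVneq j i; last exact: snN.
  exact: sn_step st.
elim: n Ms => [|n IHn] Ms snM; first by constructor=> Ns [i []].
(* Once [n] reaches the arity, no argument has index [n], and every step for [n.+1] is one for
   [n]. *)
have [ltn|gen] := ltnP n (arity c); last first.
  have := IHn Ms snM; elim=> {snM}Ms _ IH; constructor=> Ns [i [_ st eN]].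
  by apply: IH; exists i; split=> //; apply: leq_trans (ltn_ord i) gen.
have [k kn] : exists k : 'I_(arity c), n = k :> nat by exists (Ordinal ltn).
have [x ex] : exists x, x = Ms k by exists (Ms k).
have := snM k; rewrite -ex => snx.
elim: snx Ms ex snM => {}x _ IHx Ms ex snM; have := IHn Ms snM => accM.
elim: accM ex snM => {}Ms _ IHM ex snM; constructor=> Ns [i [lti st eN]].
have [ik|ik] := eqVneq i k.
  subst i; rewrite -ex in st.
  apply: (IHx _ st Ns erefl); apply: sn_args snM _ eN; rewrite -ex.
  exact: st.
apply: (IHM Ns); [exists i | | ].
- split; [ | exact: st | exact: eN]; move: lti; rewrite ltnS leq_eqVlt => /orP[/eqP e|//].
  by case/eqP: ik; apply: val_inj; rewrite /= e.
- by rewrite eN // eq_sym.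
- exact: sn_args snM st eN.
Qed.

Lemma sn_const (c : const L) (Ms : {ffun 'I_(arity c) -> term L}) :
  (forall i, sn (Ms i)) -> sn (Const Ms).
Proof.
move/(acc_argstep (arity c)); elim=> {}Ms _ IH.
constructor=> P /beta_inv [Ns [i [-> st eN]]].
by apply: IH; exists i.
Qed.

End BetaNormalization.

(** * Reducibility candidates over simple types *)

Section Reducibility.
Variable L : language.
Implicit Types (A B M N P : term L).

Inductive simple_type := Base | Arrow of simple_type & simple_type.
Implicit Types a b : simple_type.

Fixpoint red a M : Prop :=
  if a is Arrow a1 a2 then forall N, red a1 N -> red a2 (App M N) else sn M.

Definition neutral M : Prop := if M is Lam _ _ then False else True.

(** Girard's three conditions need each other: at an arrow, normalization applies [M] to a variable,
    reducible by the third condition on the domain; the third follows by induction on the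
    normalization of the argument. *)
Lemma red_candidate a :
  [/\ forall M, red a M -> sn M,
      forall M P, red a M -> beta M P -> red a P
    & forall M, neutral M -> (forall P, beta M P -> red a P) -> red a M].
Proof.
elim: a => [|a [cr1a cr2a cr3a] b [cr1b cr2b cr3b]] /=.
  by split=> [M|M P|M _ H]; [ | apply: sn_step | constructor].
split=> [M rM|M P rM MP N rN|M neM IM N rN].
- apply: (@sn_map _ (fun P => App P (Var 0))); first by move=> *; apply: cc_app_l.
  by apply/cr1b/rM/cr3a => // P /beta_inv.
- by apply: cr2b (rM _ rN) _; apply: cc_app_l.
- have := cr1a _ rN => snN; elim: snN rN => {}N _ IHN rN.
  apply: cr3b => // P /beta_inv [[A [M0 [eM _]]]|[M' MM' ->]|[N' NN' ->]].
  + by rewrite eM in neM.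
  + exact: IM.
  + by apply: IHN => //; apply: cr2a NN'.
Qed.

Lemma red_sn a M : red a M -> sn M.
Proof. by case: (red_candidate a) => + _ _; apply. Qed.

Lemma red_step a M P : red a M -> beta M P -> red a P.
Proof. by case: (red_candidate a) => _ + _; apply. Qed.

Lemma red_neutral a M :
  neutral M -> (forall P, beta M P -> red a P) -> red a M.
Proof. by case: (red_candidate a) => _ _; apply. Qed.

Lemma red_var a k : red a (Var k).
Proof. by apply: red_neutral => // P /beta_inv. Qed.

(** A reduct of [Const Ms] is again a constant, hence neutral, so normalization alone gives
    reducibility at every simple type. *)
Lemma red_const a (c : const L) (Ms : {ffun 'I_(arity c) -> term L}) :
  sn (Const Ms) -> red a (Const Ms).
Proof.
move=> snM; have [Q eQ] : exists Q, Q = Const Ms by exists (Const Ms).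
rewrite -eQ in snM *; elim: snM Ms eQ => {}Q _ IH Ms eQ; subst Q.
apply: red_neutral => // P st; have [Ns [i [eP _ _]]] := beta_inv st.
exact: IH st _ eP.
Qed.

(** Instantiating index 0 with a variable preserves steps, so an infinite reduction of the body
    would survive it. *)
Lemma sn_body s M : sn (subst (scons (Var 0) s) M) -> sn (subst (up s) M).
Proof.
rewrite -subst1_up; apply: (@sn_map _ (fun M => subst1 M (Var 0))) => N P.
exact: beta_subst.
Qed.

(** Nested induction on the normalization of the annotation, the body and the argument; the redex
    itself contracts to an instance that is reducible by hypothesis. *)
Lemma red_lam a b A M :
  sn A -> sn M -> (forall N, red a N -> red b (subst1 M N)) ->
  red (Arrow a b) (Lam A M).
Proof.
move=> snA; elim: snA M => {}A snA IHA M snM; elim: snM => {}M snM IHM rM N rN.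
have := red_sn rN => snN; elim: snN rN => {}N _ IHN rN.
apply: red_neutral => // P /beta_inv [[A0 [M0 [[_ <-] ->]]]|[Q st ->]|[N' NN' ->]].
- exact: rM.
- case/beta_inv: st => [[A' AA' ->]|[M' MM' ->]].
    by apply: (IHA _ AA' M) => //; constructor.
  apply: (IHM _ MM') => // N0 rN0; apply: red_step (rM _ rN0) _.
  exact: beta_subst.
- by apply: IHN => //; apply: red_step NN'.
Qed.

End Reducibility.

Scheme wf_mut_ind := Minimality for wf Sort Prop
  with has_type_mut_ind := Minimality for has_type Sort Prop.
Combined Scheme wf_has_type_ind from wf_mut_ind, has_type_mut_ind.

(** * Families, kinds and the stability of their erasure *)

Section Erasure.
Variables (L : language) (T : theory L).
Implicit Types (A B M N P : term L) (G : context L).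

Let S := tsig T.

(** The domain of a product must be a family as well, since its erasure enters that of the
    product. *)
Fixpoint family M : Prop :=
  match M with
  | Var _ | Sort _ => False
  | Const c _ => type_level S c
  | App M _ | Lam _ M => family M
  | Prod A B => family A /\ family B
  end.

Fixpoint kind M : Prop :=
  match M with
  | Sort SType => True
  | Prod A B => family A /\ kind B
  | _ => False
  end.

(* Meaningful on families and kinds only; the erasure of an object is junk. *)
Fixpoint erase M : simple_type :=
  match M with
  | Var _ | Const _ _ | Sort _ => Base
  | App M _ | Lam _ M => erase M
  | Prod A B => Arrow (erase A) (erase B)
  end.

Definition classifier A : Prop := family A \/ kind A.

Lemma family_not_kind A : family A -> kind A -> False.
Proof.
elim: A => [k|c Ms|s|M _ N _|A _ M _|A _ B IH] //= [_ fB] [_ kB].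
exact: IH.
Qed.

Lemma kind_prod_to_TYPE A : kind A -> prod_to_TYPE A.
Proof.
elim: A => [k|c Ms|[]|M _ N _|A _ M _|A _ B IH] //= kA; first by constructor.
by constructor; apply: IH; case: kA.
Qed.

(** A variable is not a family, so substitution never reaches a position that [family] or [erase]
    inspects. *)
Lemma family_subst A : forall s, family A ->
  family (subst s A) /\ erase (subst s A) = erase A.
Proof.
elim: A => [k|c Ms|s0|M IH N _|A _ M IH|A IHA B IHB] s //=; try exact: IH.
by case=> /(IHA s)[? ->] /(IHB (up s))[? ->].
Qed.

Lemma kind_subst A : forall s, kind A ->
  kind (subst s A) /\ erase (subst s A) = erase A.
Proof.
elim: A => [k|c Ms|s0|M _ N _|A _ M _|A _ B IHB] s //=.
by case=> /(family_subst s)[? ->] /(IHB (up s))[? ->].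
Qed.

Lemma classifier_subst A s : classifier A ->
  classifier (subst s A) /\ erase (subst s A) = erase A.
Proof.
by case=> [/(family_subst s)|/(kind_subst s)] [? ->]; split=> //; [left|right].
Qed.

(** The grammar has no products, so the erasure is that of the constant heading the left-hand
    side. *)
Lemma arity_preserving_rhs_family M : arity_preserving_rhs S M ->
  family M /\ erase M = Base.
Proof. by elim. Qed.

Hypothesis T_arity : arity_preserving T.

Lemma beta_family A B : beta A B -> family A -> family B /\ erase B = erase A.
Proof.
elim=> {A B} [P Q [A M N] /= fM|c Ms Ns i _ _ _|M M' N _ IH|M N N' _ _
  |A A' M _ _|A M M' _ IH|A A' B _ IH|A B B' _ IH] //=.
- exact: family_subst.
- by case=> /IH[? ->].
- by case=> ? /IH[? ->].
Qed.

Lemma rew_family A B :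
  rew (trules T) A B -> family A -> family B /\ erase B = erase A.
Proof.
elim=> {A B} [A B [rho s rho_in] /= tl|c Ms Ns i _ _ _|M M' N _ IH|M N N' _ _
  |A A' M _ _|A M M' _ IH|A A' B _ IH|A B B' _ IH] //=.
- have [fr er] := arity_preserving_rhs_family (T_arity rho_in tl).
  by have [? ->] := family_subst s fr.
- by case=> /IH[? ->].
- by case=> ? /IH[? ->].
Qed.

Lemma beta_rew_family A B :
  beta_rew (trules T) A B -> family A -> family B /\ erase B = erase A.
Proof. by case; [apply: beta_family | apply: rew_family]. Qed.

Lemma beta_kind A B : beta A B -> kind A -> kind B /\ erase B = erase A.
Proof.
elim=> {A B} [P Q [A M N]|c Ms Ns i _ _ _|M M' N _ _|M N N' _ _|A A' M _ _
  |A M M' _ _|A A' B st _|A B B' _ IH] //=.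
- by case=> /(beta_family st)[? ->].
- by case=> ? /IH[? ->].
Qed.

Lemma rew_kind A B :
  rew (trules T) A B -> kind A -> kind B /\ erase B = erase A.
Proof.
elim=> {A B} [A B [rho s rho_in]|c Ms Ns i _ _ _|M M' N _ _|M N N' _ _
  |A A' M _ _|A M M' _ _|A A' B st _|A B B' _ IH] //=.
- by case=> /(rew_family st)[? ->].
- by case=> ? /IH[? ->].
Qed.

Lemma beta_rew_kind A B :
  beta_rew (trules T) A B -> kind A -> kind B /\ erase B = erase A.
Proof. by case; [apply: beta_kind | apply: rew_kind]. Qed.

Notation reduces := (clos_refl_trans (term L) (beta_rew (trules T))).

Lemma reduces_family A B :
  reduces A B -> family A -> family B /\ erase B = erase A.
Proof.
elim=> {A B} [A B /beta_rew_family|//|A B C _ IH1 _ IH2 /IH1[/IH2[? ->] ->]] //.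
Qed.

Lemma reduces_kind A B : reduces A B -> kind A -> kind B /\ erase B = erase A.
Proof.
elim=> {A B} [A B /beta_rew_kind|//|A B C _ IH1 _ IH2 /IH1[/IH2[? ->] ->]] //.
Qed.

(** A beta redex is an application and an instance of a left-hand side is a constant, so a sort is
    normal. *)
Lemma reduces_KIND A B : reduces A B -> A = KIND -> B = KIND.
Proof.
elim=> {A B} [A B st eA|//|A B C _ IH1 _ IH2 /IH1/IH2] //.
have root_KIND R M N : ctx_closure R M N -> M = KIND -> R M N by case.
subst A; case: st => /root_KIND/(_ erefl) st; first by inversion st.
have lhs_const M N : rule_root (trules T) M N -> if M is Const _ _ then True else False.
  by case.
by have := lhs_const _ _ st.
Qed.

(** * Conversion of classifiers under confluence *)

Hypothesis T_confluent : confluent (beta_rew (trules T)).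

Lemma conv_join A B :
  conv (trules T) A B -> exists2 C, reduces A C & reduces B C.
Proof.
elim=> {A B} [A B st|A|A B _ [C AC BC]|A B C _ [D AD BD] _ [E BE CE]].
- by exists B; [apply: rt_step | apply: rt_refl].
- by exists A; apply: rt_refl.
- by exists C.
- have [F DF EF] := T_confluent BD BE.
  by exists F; [apply: rt_trans AD DF | apply: rt_trans CE EF].
Qed.

(** The common reduct inherits level and erasure from both sides; in the mixed cases it would be
    both a family and a kind. *)
Lemma conv_classifier A B : conv (trules T) A B ->
  classifier A -> classifier B ->
  [/\ erase A = erase B, family A -> family B & kind A -> kind B].
Proof.
move=> /conv_join[C AC BC] [fA|kA] [fB|kB].
- have [_ <-] := reduces_family AC fA; have [_ <-] := reduces_family BC fB.
  by split=> // /(family_not_kind fA).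
- have [fC _] := reduces_family AC fA; have [kC _] := reduces_kind BC kB.
  by case: (family_not_kind fC).
- have [kC _] := reduces_kind AC kA; have [fC _] := reduces_family BC fB.
  by case: (family_not_kind fC).
- have [_ <-] := reduces_kind AC kA; have [_ <-] := reduces_kind BC kB.
  by split=> // /family_not_kind/(_ kA).
Qed.

(** Rules out that the conversion rule gives a kind a type other than [KIND]. *)
Lemma conv_KIND A : conv (trules T) KIND A -> ~ classifier A.
Proof.
move=> /conv_join[C /reduces_KIND-/(_ erefl) -> AC].
by case=> [/(reduces_family AC)|/(reduces_kind AC)] [].
Qed.

(** * Stratification of typing judgments into levels *)

(* A constant may be declared several times, so the subject of the last case
   may well be a family too. *)
Definition level M A : Prop :=
  [\/ A = KIND /\ kind M, kind A /\ family M | family A].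

Lemma level_sort A s : level A (Sort s) -> classifier A.
Proof. by case=> [[_ ?]|[_ ?]|//]; [right|left]. Qed.

Lemma level_TYPE A : level A TYPE -> family A.
Proof. by case=> [[]|[]|]. Qed.

Lemma level_KIND A : level A KIND -> kind A.
Proof. by case=> [[]|[]|]. Qed.

Definition context_families G := forall k A, onth G k = Some A -> family A.

Lemma wf_has_type_level :
  (forall G, wf T G -> context_families G) /\
  (forall G M A, has_type T G M A -> context_families G /\ level M A).
Proof.
apply: wf_has_type_ind => [|G A _ [cG /level_TYPE fA]
  |G d Ms s d_in _ [_ lvA] _ cG _ _|G _ cG|G k A _ cG Gk
  |G M A B s _ [cG lvM] _ [_ lvB] AB|G A B s _ [cG /level_TYPE fA] _ [_ lvB]
  |G M N A B _ [cG lvM] _ _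
  |G A B M s _ [cG /level_TYPE fA] _ [_ lvB] _ [_ lvM]].
- by case.
- by case=> [|k] B /=; [case=> <- | apply: cG].
- split=> //; case: s lvA => [/level_TYPE fA|/level_KIND kA].
    by constructor 3; apply: (family_subst _ fA).1.
  constructor 2; split; first exact: (kind_subst _ kA).1.
  by exists d; split=> //; apply: kind_prod_to_TYPE.
- by split=> //; constructor 1.
- split=> //; constructor 3; rewrite rename_subst.
  exact: (family_subst _ (cG _ _ Gk)).1.
(* The target type is itself typed by a sort, hence a classifier, and conversion between classifiers
   keeps the level. *)
- split=> //; have clB := level_sort lvB.
  case: lvM => [[eA kM]|[kA fM]|fA].
  + by rewrite eA in AB; case: (conv_KIND AB).
  + by constructor 2; split=> //; case: (conv_classifier AB) => // [|_ _]; [right|apply].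
  + by constructor 3; case: (conv_classifier AB) => // [|_ + _]; [left|apply].
- split=> //; case: s lvB => [/level_TYPE fB|/level_KIND kB].
    by constructor 2.
  by constructor 1.
- split=> //; case: lvM => [[]|[/= [fA kB] fM]|/= [fA fB]] //.
    by constructor 2; split=> //; apply: (kind_subst _ kB).1.
  by constructor 3; apply: (family_subst _ fB).1.
- split=> //; case: s lvB => [/level_TYPE fB|/level_KIND kB]; first by constructor 3.
  (* As [B] is a kind, it is neither [KIND] nor a family, which forces the body to be a family. *)
  constructor 2; split=> //=; case: lvM => [[eB _]|[_ //]|/family_not_kind//].
  by rewrite eB in kB.
Qed.

Lemma wf_context_families G : wf T G -> context_families G.
Proof. exact: wf_has_type_level.1. Qed.

Lemma has_type_level G M A : has_type T G M A -> level M A.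
Proof. by case/wf_has_type_level.2. Qed.

Lemma has_type_prod_classifier G M A B :
  has_type T G M (Prod A B) -> classifier B.
Proof. by case/has_type_level=> [[]|[[_ ?] _]|[_ ?]] //; [right|left]. Qed.

(** * The fundamental lemma of reducibility *)

Definition red_subst G (s : nat -> term L) :=
  forall k A, onth G k = Some A -> red (erase A) (s k).

Lemma red_subst_scons G s A N :
  red_subst G s -> red (erase A) N -> red_subst (A :: G) (scons N s).
Proof. by move=> rs rN [|k] B /=; [case=> <- | apply: rs]. Qed.

(** Quantifying over all reducible substitutions lets the abstraction case extend the substitution
    with any reducible argument. *)
Lemma has_type_red G M A : has_type T G M A ->
  forall s, red_subst G s -> red (erase A) (subst s M).
Proof.
elim=> {G M A} [G d Ms s d_in _ _ _ _ IH|G _|G k A wfG Gk|G M A B s tyM IH tyB _ AB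
  |G A B s _ IHA _ IHB|G M N A B tyM IHM _ IHN|G A B M s _ IHA _ _ _ IHM] t rt.
- apply/red_const/sn_const => i; rewrite ffunE.
  exact: red_sn (IH i _ rt).
- exact: sn_sort.
(* Shifting a family keeps its erasure, which is why [red_subst] can use the unshifted type. *)
- rewrite rename_subst (family_subst _ (wf_context_families wfG Gk)).2.
  exact: rt.
- have clB := level_sort (has_type_level tyB).
  case: (has_type_level tyM) => [[eA _]|[kA _]|fA].
  + by rewrite eA in AB; case: (conv_KIND AB).
  + by case: (conv_classifier AB (or_intror kA) clB) => <- _ _; apply: IH.
  + by case: (conv_classifier AB (or_introl fA) clB) => <- _ _; apply: IH.
- apply: sn_prod; first exact: IHA.
  by apply/sn_body/IHB/red_subst_scons => //; apply: red_var.
(* Erasure forgets the dependency of [B] on [N], so the arrow type of [M] suffices. *)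
- rewrite (classifier_subst _ (has_type_prod_classifier tyM)).2.
  by apply: (IHM _ rt); apply: IHN.
- apply: red_lam => [||N rN]; first exact: IHA.
    by apply/sn_body/red_sn/IHM/red_subst_scons => //; apply: red_var.
  by rewrite subst1_up; apply/IHM/red_subst_scons.
Qed.

Lemma has_type_sn G M A : has_type T G M A -> sn M.
Proof.
move=> tyM; have <- : subst Var M = M by apply: subst_var.
by apply: red_sn (has_type_red tyM _) => k B _; apply: red_var.
Qed.

End Erasure.

Theorem mainTheorem1 (L : language) (T : theory L)
    (Hconfl : confluent (beta_rew (trules T)))
    (Harity : arity_preserving T) :
  forall (G : context L) (M A : term L), has_type T G M A ->
    ~ exists f : nat -> term L, f 0 = M /\ forall n, beta (f n) (f n.+1).
Proof.
move=> G M A /(has_type_sn Harity Hconfl) snM [f [f0 fS]].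
(* Quantified over all positions, because the induction passes from [f n] to [f n.+1]. *)
have sn_unreached P : sn P -> forall n, f n <> P.
  elim=> {}P _ IH n fn; have := fS n; rewrite fn => /IH/(_ n.+1); exact.
exact: sn_unreached snM 0 f0.
Qed.
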